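(* Let $i\in\{1,2\}$. Every second-countable $T_i$-space $X$ of cardinality $|X|<\mathfrak q_i$ is symmetrizable.
   Context: A symmetric on a set $X$ is a function $d:X\times X\to[0,\infty)$ such that for all $x,y\in X$: (1) $d(x,y)=0$ if and only if $x=y$; (2) $d(x,y)=d(y,x)$. (No triangle inequality is required.) For $x\in X$ and $\varepsilon>0$ put $B_d(x;\varepsilon)=\{y\in X:d(x,y)<\varepsilon\}$. The topology of a topological space $X$ is generated by $d$ if a subset $U\subseteq X$ is open if and only if for every $x\in U$ there exists $\varepsilon>0$ such that $B_d(x;\varepsilon)\subseteq U$. A topological space is symmetrizable if its topology is generated by some symmetric. A topological space $X$ is a $Q$-space if every subset of $X$ is of type $G_\delta$ in $X$ (an intersection of countably many open sets). For $i\in\{1,2\}$, the cardinal $\mathfrak q_i$ is the smallest cardinality of a second-countable $T_i$-space which is not a $Q$-space ($T_2$ means Hausdorff). *)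

(* Defs.v *)
From mathcomp Require Import all_boot all_order all_algebra.
From mathcomp Require Import all_classical all_reals all_analysis.
From mathcomp Require Import borel_hierarchy.

Set Implicit Arguments.
Unset Strict Implicit.
Unset Printing Implicit Defensive.

Import Order.TTheory GRing.Theory Num.Theory.
Import numFieldNormedType.Exports.

Local Open Scope classical_set_scope.
Local Open Scope card_scope.
Local Open Scope ring_scope.

Definition is_symmetric (R : realType) (X : Type) (d : X -> X -> R) : Prop :=
  [/\ forall x y, 0 <= d x y,
      forall x y, d x y = 0 <-> x = y
    & forall x y, d x y = d y x].

Definition sym_ball (R : realType) (X : Type) (d : X -> X -> R) (x : X) (e : R)
  : set X := [set y | d x y < e].

Definition generates_topology (R : realType) (X : topologicalType)
    (d : X -> X -> R) : Prop :=
  forall U : set X, open U <->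
    forall x, U x -> exists2 e : R, 0 < e & sym_ball d x e `<=` U.

Definition symmetrizable (R : realType) (X : topologicalType) : Prop :=
  exists2 d : X -> X -> R, is_symmetric d & generates_topology d.

Definition Q_space (X : topologicalType) : Prop := forall A : set X, Gdelta A.

Variant sep_index := T1 | T2.

Definition T_space (i : sep_index) (X : topologicalType) : Prop :=
  match i with
  | T1 => accessible_space X
  | T2 => hausdorff_space X
  end.

Definition second_countable_nonQ (i : sep_index) (Y : topologicalType) : Prop :=
  [/\ @second_countable Y, T_space i Y & ~ Q_space Y].

(* MathComp-Analysis has no type of cardinals, so the cardinal q_i is described
   up to equinumerosity: [is_q i K] says that K is a set of cardinality q_i. *)
Definition is_q (i : sep_index) (K : Type) : Prop :=
  (exists2 Y : topologicalType,
     second_countable_nonQ i Y & [set: Y] #= [set: K]) /\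
  (forall Y : topologicalType,
     second_countable_nonQ i Y -> [set: K] #<= [set: Y]).

Definition card_lt (T U : Type) (A : set T) (B : set U) : Prop :=
  A #<= B /\ A #!= B.

Lemma min_card (I : Type) (T_ : I -> Type) (i0 : I) :
  exists i, forall j, [set: T_ i] #<= [set: T_ j].
Proof.
pose P (S : set (forall i, T_ i)) :=
  forall f g, S f -> S g -> forall i, f i = g i -> f = g.
have [F FP Ftot|S [PS maxS]] := @Zorn_bigcup _ P.
  move=> f g [A FA Af] [B FB Bg] i fg.
  have [AB|BA] := Ftot _ _ FA FB.
  - exact: (FP _ FB f g (AB _ Af) Bg i).
  - exact: (FP _ FA f g Af (BA _ Bg) i).
have [i surj] : exists i, forall y : T_ i, exists2 f, S f & f i = y.
  apply: contrapT => h.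
  have {}h i : {y : T_ i | forall f, S f -> f i <> y}.
    apply: cid; apply: contrapT => hi; apply: h; exists i => y.
    apply: contrapT => hy; apply: hi; exists y => f Sf fy; apply: hy; by exists f.
  pose g i := sval (h i).
  have gS f i : S f -> f i <> g i by move=> Sf; exact: (svalP (h i)).
  apply: (maxS (S `|` [set g])).
    split; first by move=> f Sf; left.
    by move=> /(_ g (or_intror erefl)) /(gS g i0); apply.
  move=> f1 f2 [S1|->] [S2|->] i e //.
  - exact: PS e.
  - by case: (gS _ i S1).
  - by case: (gS _ i S2).
exists i => j.
have /choice[s sP] : forall y : T_ i, exists f, S f /\ f i = y.
  by move=> y; have [f ? ?] := surj y; exists f.
have inj : injective (fun y => s y j).
  move=> y z e; have [Sy <-] := sP y; have [Sz <-] := sP z.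
  by rewrite (PS _ _ Sy Sz j e).
have /card_esym/card_eqPle[le _] : (fun y => s y j) @` [set: T_ i] #= [set: T_ i].
  by apply: inj_card_eq => y z _ _; exact: inj.
exact: (card_le_trans le (card_leT _)).
Qed.

Lemma R_second_countable (R : realType) : @second_countable R.
Proof.
exists (range (fun cr : rat * rat => ball (ratr cr.1 : R) (ratr cr.2))).
  exact/(card_le_trans (card_image_le _ _))/countableP.
split=> [_ [cr _ <-]|x A /= ]; first exact: ball_open.
rewrite nbhsE => -[U [oU Ux] UA].
have [c [r /= [xB BU]]] := open_subball_rat oU (mem_set Ux).
exists (ball (ratr c : R) (ratr r : R)); last exact: subset_trans UA.
split; last exact/set_mem.
by exists (c, r).
Qed.

(* The cardinals q_i exist: the real line is not a Q-space, and every nonempty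
   class of cardinals has a least element. *)
Lemma is_q_exists (R : realType) (i : sep_index) : exists K, is_q i K.
Proof.
have RP : second_countable_nonQ i R.
  split; first exact: R_second_countable.
    by case: (i) => /=; [apply: hausdorff_accessible|]; exact: Rhausdorff.
  by move=> /(_ (@rational _)); exact: not_rational_Gdelta.
pose P (A : set R) :=
  exists2 Y : topologicalType, second_countable_nonQ i Y & [set: Y] #= A.
have PT : P setT by exists R.
have [[A PA] Amin] := @min_card {A | P A} (fun A => set_type (sval A)) (exist _ _ PT).
exists A; split.
  case: (PA) => Y YP YA; exists Y => //.
  exact: card_eq_trans YA (card_esym (card_setT A)).
move=> Y YP.
have [[] /= min] := @min_card bool (fun b => if b then (set_type A : Type) else (Y : Type)) true.
  exact: (min false).
have YR : [set: Y] #<= [set: R].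
  apply: card_le_trans (min true) _.
  by rewrite (card_le_eql (card_setT A)); exact: card_leT.
have [f finj] := pcard_injP YR.
have YE : [set: Y] #= range f by exact/card_esym/inj_card_eq.
have PE : P (range f) by exists Y.
have := Amin (exist _ _ PE); rewrite /= (card_le_eqr (card_setT _)).
by rewrite (card_le_eqr YE).
Qed.

(* Main.v *)
Require Import Defs.
From mathcomp Require Import all_boot all_order all_algebra.
From mathcomp Require Import all_classical all_reals all_analysis.
From mathcomp Require Import borel_hierarchy.

(** Since |X| < q_i, the minimality of q_i makes X a Q-space; in particular, its
    closed sets are of type G_delta. A second-countable T_0-space with that
    property is symmetrizable ([perfect_symmetrizable]), for the following
    reason.

    Complements of basic open sets are countable intersections of open sets, so
    countably many two-element open covers {U n, G n} of X suffice to describe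
    the topology: every neighbourhood of x contains some U n with x outside of
    G n ([exists_describing_covers]). Say that the n-th cover tolerates x and y
    if, whenever one of the points is outside of G n, the other is in U n. This
    relation is reflexive, because U n and G n cover X, and symmetric. The
    points that it relates to x form the whole space, U n or G n, and hence a
    neighbourhood of x. If x is outside of G n, they lie in U n. So the sets of
    points that the first m covers tolerate with x are neighbourhoods of x, and
    they form a neighbourhood base at x as m varies.

    The distance between x and y is then the inverse of the rank of the first
    cover that does not tolerate them, or 0 if all covers do; the balls are the
    sets just described, and d(x, y) = 0 forces x = y because X is T_0. *)

Set Implicit Arguments.
Unset Strict Implicit.
Unset Printing Implicit Defensive.

Import Order.TTheory GRing.Theory Num.Theory.

Local Open Scope classical_set_scope.
Local Open Scope ring_scope.

Section FirstFailure.
Variable R : realType.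

Definition inv_first_failure (P : nat -> Prop) : R :=
  if pselect (exists n, `[< ~ P n >]) is left ex then (ex_minn ex).+1%:R^-1
  else 0.

Lemma inv_first_failure_ge0 P : 0 <= inv_first_failure P.
Proof. by rewrite /inv_first_failure; case: pselect => // ex; rewrite invr_ge0. Qed.

Lemma inv_first_failure_lt P m :
  inv_first_failure P < m.+1%:R^-1 <-> forall n, (n <= m)%N -> P n.
Proof.
rewrite /inv_first_failure; case: pselect => [ex|nex]; last first.
  rewrite invr_gt0 ltr0n; split=> // _ n _.
  by apply: contrapT => nPn; apply: nex; exists n; exact/asboolP.
case: ex_minnP => k /asboolP nPk kmin.
rewrite ltf_pV2 ?posrE ?ltr0n// ltr_nat ltnS; split=> [mk n nm|Pm].
  apply: contrapT => nPn.
  by have := kmin n (asboolT nPn); rewrite leqNgt (leq_ltn_trans nm mk).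
by rewrite ltnNge; apply/negP => /Pm.
Qed.

Lemma inv_first_failure_eq0 P : inv_first_failure P = 0 <-> forall n, P n.
Proof.
split=> [P0 n|Pall].
  apply: (proj1 (inv_first_failure_lt P n)) (leqnn n).
  by rewrite P0 invr_gt0 ltr0n.
rewrite /inv_first_failure; case: pselect => // ex.
by have [n /asboolP[]] := ex; exact: Pall.
Qed.

End FirstFailure.

Lemma second_countable_sequence (X : topologicalType) :
  @second_countable X -> exists2 U : nat -> set X,
    forall n, open (U n) &
    forall x V, nbhs x V -> exists n, U n x /\ U n `<=` V.
Proof.
move=> [B /countable_injP[f finj] [Bopen Bbase]].
(* The n-th union is the member of B with code n, or the empty set if n is not
   a code. *)
exists (fun n => \bigcup_(A in [set A | B A /\ f A = n]) A) => [n|x V xV].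
  by apply: bigcup_open => A [/Bopen].
have [A [BA Ax] AV] := Bbase x V xV; exists (f A); split.
  by exists A.
move=> y [A' [BA' fA'] A'y]; apply: AV.
by rewrite -(finj A' A (mem_set BA') (mem_set BA) fA').
Qed.

(** The covers are the pairs formed by a basic open set U and one of the open
    sets that intersect to the complement of U. *)
Lemma exists_describing_covers (X : topologicalType) :
  @second_countable X -> (forall F : set X, closed F -> Gdelta F) ->
  exists U G : nat -> set X,
    [/\ forall n, open (U n), forall n, open (G n),
        forall n x, U n x \/ G n x &
        forall x V, nbhs x V -> exists n, ~ G n x /\ U n `<=` V].
Proof.
move=> /second_countable_sequence[U Uopen Ubase] Xperfect.
have /choice[G GP] n : exists G : nat -> set X,
    (forall k, open (G k)) /\ ~` U n = \bigcap_k G k.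
  by have [G ? ?] := Xperfect _ (open_closedC (Uopen n)); exists G.
pose code p : nat * nat := odflt (0, 0)%N (unpickle p).
exists (fun p => U (code p).1), (fun p => G (code p).1 (code p).2).
split=> [p|p|p x|x V xV]; first exact: Uopen.
- by have [+ _] := GP (code p).1; apply.
- have [Ux|nUx] := pselect (U (code p).1 x); [by left|right].
  by have [_ UG] := GP (code p).1; have : (~` U (code p).1) x by []; rewrite UG; apply.
have [n [Unx UV]] := Ubase x V xV; have [_ UG] := GP n.
have [k nGx] : exists k, ~ G n k x.
  apply: contrapT => nex; suff : (~` U n) x by [].
  by rewrite UG => k _; apply: contrapT => ?; apply: nex; exists k.
by exists (pickle (n, k)); rewrite /code pickleK.
Qed.

Definition tolerated (X : Type) (U G : set X) (x y : X) : Prop :=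
  (G x \/ U y) /\ (G y \/ U x).

Lemma tolerated_sym (X : Type) (U G : set X) (x y : X) :
  tolerated U G x y = tolerated U G y x.
Proof. by apply/propext; rewrite /tolerated; split=> -[]. Qed.

(** The set of points tolerated with x is G if x is outside of U, the whole space
    if x is in both sets, and U if x is outside of G. *)
Lemma nbhs_tolerated (X : topologicalType) (U G : set X) (x : X) :
  open U -> open G -> U x \/ G x -> nbhs x (tolerated U G x).
Proof.
move=> Uopen Gopen xUG.
have [Ux|nUx] := pselect (U x); last first.
  have Gx : G x by case: xUG.
  by apply: filterS (open_nbhs_nbhs (conj Gopen Gx)) => y Gy; split; left.
have [Gx|nGx] := pselect (G x).
  by apply: filterS filterT => y _; split; [left|right].
by apply: filterS (open_nbhs_nbhs (conj Uopen Ux)) => y Uy; split; right.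
Qed.

Lemma perfect_symmetrizable (R : realType) (X : topologicalType) :
  @second_countable X -> kolmogorov_space X ->
  (forall F : set X, closed F -> Gdelta F) -> symmetrizable R X.
Proof.
move=> Xsc T0 Xperfect.
have [U [G [Uopen Gopen UG describe]]] := exists_describing_covers Xsc Xperfect.
pose tol x y n := tolerated (U n) (G n) x y.
exists (fun x y => inv_first_failure R (tol x y)).
  split=> [x y|x y|x y]; first exact: inv_first_failure_ge0.
  - rewrite inv_first_failure_eq0; split=> [xy|<- n]; last first.
      by rewrite /tol /tolerated; have := UG n x; tauto.
    apply: contrapT => /eqP /T0[A sep].
    wlog [xA yA] : x y xy sep / A \in nbhs x /\ y \in ~` A.
      move=> wlog_x; case: (sep); first by apply: wlog_x.
      apply: (wlog_x y x); last by case: sep; [right|left].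
      by move=> n; rewrite /tol tolerated_sym; exact: xy.
    have [n [nGx UA]] := describe _ _ (set_mem xA).
    have [[//|/UA Ay] _] := xy n.
    by move/set_mem: yA; apply.
  - by congr inv_first_failure; apply/funext => n; exact: tolerated_sym.
move=> V; split=> [Vopen x Vx|Vball].
  have [m [nGx UV]] := describe x V (open_nbhs_nbhs (conj Vopen Vx)).
  exists m.+1%:R^-1; first by rewrite invr_gt0 ltr0n.
  move=> y /inv_first_failure_lt /(_ m (leqnn m)) [[//|/UV]] //.
rewrite openE => x /Vball[e e0 ballV].
have [m] := ltr_add_invr e0; rewrite add0r => me.
have : nbhs x [set y | forall n : 'I_m.+1, tol x y n].
  by apply: filter_forall => n; exact: nbhs_tolerated.
apply: filterS => y toly; apply: ballV; apply: lt_trans me.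
by apply/inv_first_failure_lt => n nm; exact: toly (Ordinal (nm : (n < m.+1)%N)).
Qed.

Lemma card_lt_q_Q_space (i : sep_index) (K : Type) (X : topologicalType) :
  is_q i K -> @second_countable X -> T_space i X ->
  card_lt [set: X] [set: K] -> Q_space X.
Proof.
move=> [_ qmin] Xsc Ti [XK /negP XneqK]; apply: contrapT => nQ.
by apply: XneqK; rewrite card_eq_le XK qmin.
Qed.

Lemma T_space_accessible (i : sep_index) (X : topologicalType) :
  T_space i X -> accessible_space X.
Proof. by case: i => //; exact: hausdorff_accessible. Qed.

Theorem proposition9 (R : realType) (i : sep_index) (K : Type)
    (hK : is_q i K) (X : topologicalType) (hX2 : @second_countable X)
    (hXi : T_space i X) (hXK : card_lt [set: X] [set: K]) :
  symmetrizable R X.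
Proof.
apply: perfect_symmetrizable => // [|F _].
  exact/accessible_kolmogorov/T_space_accessible/hXi.
exact: card_lt_q_Q_space hK hX2 hXi hXK F.
Qed.
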